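(* Let $\mathcal{H}$ be a finite-dimensional Hilbert space, $|\phi_1\rangle,\dots,|\phi_K\rangle\in\mathcal{H}$ unit vectors, $\mathcal{H}_\Pi$ their span with orthogonal projector $\Pi$, and $\lambda_{\min}$ the minimum nonzero eigenvalue of $K^{-1}\sum_{k=1}^K|\phi_k\rangle\langle\phi_k|$. For a qubit $a$ let $R_a(k)=|0\rangle\langle0|_a\otimes I+|1\rangle\langle1|_a\otimes e^{i\pi|\phi_k\rangle\langle\phi_k|}$. Consider the procedure: (i) prepare qubits $a_1,\dots,a_T$ in $|-\rangle=(|0\rangle-|1\rangle)/\sqrt2$, choose $k_1,\dots,k_T$ independently and uniformly from $\{1,\dots,K\}$, and apply successively $R_{a_1}(k_1),\dots,R_{a_T}(k_T)$ (each to the system and the indicated qubit); (ii) perform the two-outcome measurement $\{|-\rangle\langle-|^{\otimes T},I-|-\rangle\langle-|^{\otimes T}\}$ on $a_1\cdots a_T$, where the first outcome is declared to correspond to $I-\Pi$ and the second to $\Pi$; (iii) apply successively $R_{a_T}(k_T),\dots,R_{a_1}(k_1)$. Let $\mathcal{E}$ be the channel describing the overall effect on the system when the measurement outcome is ignored. If the support of the system state $\rho$ is contained in $\mathcal{H}_\Pi$ or in its orthogonal complement, then the probability that the procedure outputs the outcome different from the one corresponding to that subspace is at most $(1-\lambda_{\min})^T$, and $F(\mathcal{E}(\rho),\rho)\ge1-(1-\lambda_{\min})^T$.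
   Context: $F(\sigma_1,\sigma_2)=\mathrm{Tr}\sqrt{\sqrt{\sigma_1}\sigma_2\sqrt{\sigma_1}}$ is the Uhlmann fidelity. $e^{i\pi|\phi\rangle\langle\phi|}=I-2|\phi\rangle\langle\phi|$. The controlled reflections are assumed perfect. *)

(* Defs.v *)
From HB Require Import structures.
From mathcomp Require Import all_boot all_order all_algebra.
From mathcomp.real_closed Require Import mxtens.
From Stdlib Require Import ClassicalEpsilon.
Set Implicit Arguments. Unset Strict Implicit. Unset Printing Implicit Defensive.
Import Order.TTheory GRing.Theory Num.Theory.
Local Open Scope ring_scope.

Section Quantum.
Variable C : numClosedFieldType.

Definition adjmx m n (A : 'M[C]_(m, n)) : 'M[C]_(n, m) := (map_mx Num.conj A)^T.

Definition psdmx n (A : 'M[C]_n) : Prop :=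
  A = adjmx A /\ forall v : 'cV[C]_n, 0 <= (adjmx v *m A *m v) 0 0.

Definition densitymx n (A : 'M[C]_n) : Prop := psdmx A /\ \tr A = 1.

(* the positive semidefinite square root (chosen; unique for psd A) *)
Definition sqrtm n (A : 'M[C]_n) : 'M[C]_n :=
  epsilon (inhabits 0) (fun B : 'M[C]_n => psdmx B /\ B *m B = A).

Definition fidelity n (s1 s2 : 'M[C]_n) : C :=
  \tr (sqrtm (sqrtm s1 *m s2 *m sqrtm s1)).

(* e^{i pi |phi><phi|} = I - 2 |phi><phi| *)
Definition refl n (phi : 'cV[C]_n) : 'M[C]_n := 1%:M - 2%:R *: (phi *m adjmx phi).

Definition ket0 : 'cV[C]_2 := \col_i (i == 0 :> 'I_2)%:R.
Definition ket1 : 'cV[C]_2 := \col_i (i == 1 :> 'I_2)%:R.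
Definition ketm : 'cV[C]_2 := (sqrtC 2%:R)^-1 *: (ket0 - ket1).
Definition proj2 (v : 'cV[C]_2) : 'M[C]_2 := v *m adjmx v.

(* T qubits a_1..a_T : basis index i : 'I_(2^T); bit of qubit t (0-based) *)
Definition qbit T (t : 'I_T) (i : 'I_(2 ^ T)) : 'I_2 := inord (odd (i %/ 2 ^ t)).

(* I (x) A (x) I : the single-qubit operator A acting on qubit t *)
Definition embed1 T (t : 'I_T) (A : 'M[C]_2) : 'M[C]_(2 ^ T) :=
  \matrix_(i, j) (A (qbit t i) (qbit t j) *
     [forall s : 'I_T, (s != t) ==> (qbit s i == qbit s j)]%:R).

Definition ctrl_refl T n (t : 'I_T) (phi : 'cV[C]_n) : 'M[C]_(2 ^ T * n) :=
  embed1 t (proj2 ket0) *t 1%:M + embed1 t (proj2 ket1) *t refl phi.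

Definition minusT T : 'M[C]_(2 ^ T) := \prod_(t < T) embed1 t (proj2 ketm).

Definition ptrace T n (X : 'M[C]_(2 ^ T * n)) : 'M[C]_n :=
  \matrix_(s, s') \sum_(a < 2 ^ T) X (mxtens_index (a, s)) (mxtens_index (a, s')).

Section Procedure.
Variables (n K T : nat) (phi : 'I_K -> 'cV[C]_n).

(* step (i): apply R_{a_1}(k_1), then ..., then R_{a_T}(k_T):
   the operator R_{a_T}(k_T) ... R_{a_1}(k_1) *)
Definition U_fwd (ks : {ffun 'I_T -> 'I_K}) : 'M[C]_(2 ^ T * n) :=
  \prod_(t < T) ctrl_refl (rev_ord t) (phi (ks (rev_ord t))).

(* step (iii): apply R_{a_T}(k_T), then ..., then R_{a_1}(k_1):
   the operator R_{a_1}(k_1) ... R_{a_T}(k_T) *)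
Definition U_bwd (ks : {ffun 'I_T -> 'I_K}) : 'M[C]_(2 ^ T * n) :=
  \prod_(t < T) ctrl_refl t (phi (ks t)).

Definition Mfirst : 'M[C]_(2 ^ T * n) := minusT T *t 1%:M.
Definition Msecond : 'M[C]_(2 ^ T * n) := 1%:M - Mfirst.

Definition after_i (rho : 'M[C]_n) ks : 'M[C]_(2 ^ T * n) :=
  U_fwd ks *m (minusT T *t rho) *m adjmx (U_fwd ks).

Definition prob_first (rho : 'M[C]_n) : C :=
  ((K ^ T)%:R)^-1 * \sum_(ks : {ffun 'I_T -> 'I_K}) \tr (Mfirst *m after_i rho ks).
Definition prob_second (rho : 'M[C]_n) : C :=
  ((K ^ T)%:R)^-1 * \sum_(ks : {ffun 'I_T -> 'I_K}) \tr (Msecond *m after_i rho ks).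

Definition chanE (rho : 'M[C]_n) : 'M[C]_n :=
  ((K ^ T)%:R)^-1 *: \sum_(ks : {ffun 'I_T -> 'I_K})
    ptrace (U_bwd ks *m
      (Mfirst *m after_i rho ks *m Mfirst + Msecond *m after_i rho ks *m Msecond)
      *m adjmx (U_bwd ks)).

Definition gram_avg : 'M[C]_n := ((K%:R)^-1) *: \sum_(k < K) phi k *m adjmx (phi k).

(* H_Pi = span{phi_k} as column span of the n x K matrix [phi_1 ... phi_K] *)
Definition phimx : 'M[C]_(n, K) := \matrix_(i, k) phi k i 0.

(* support (column space) of rho contained in H_Pi *)
Definition supp_in_span (rho : 'M[C]_n) : bool := (rho^T <= phimx^T)%MS.
Definition supp_in_perp (rho : 'M[C]_n) : Prop :=
  forall k, adjmx (phi k) *m rho = 0.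
End Procedure.
End Quantum.

(* Main.v *)
Require Import Defs.
From HB Require Import structures.
From mathcomp Require Import all_boot all_order all_algebra.
From mathcomp.real_closed Require Import mxtens.
From mathcomp Require Import ring.
From Stdlib Require Import ClassicalEpsilon.
Set Implicit Arguments. Unset Strict Implicit. Unset Printing Implicit Defensive.
Import Order.TTheory GRing.Theory Num.Theory.
Local Open Scope ring_scope.

(* Compressing R_{a_t}(k) to |->_{a_t} leaves Q_k = I - |phi_k><phi_k|, so the
   first outcome occurs with probability the mean of tr(S rho S'), where
   S = Q_{k_T} ... Q_{k_1} and S' is its adjoint.  Averaging one factor over k
   multiplies the trace by at most 1 - lam on states supported in the span, and
   fixes states supported in its complement.
   For the fidelity, keep only the environment component |-^T> of the final
   state: E(rho) dominates the mean of B rho B both for B = S' S and for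
   B = I - S' S, hence (convexity of B |-> B rho B) it dominates m rho m with m
   the mean of B.  Operator monotonicity of the square root then gives
   F(E(rho), rho) >= tr(m rho), which is the probability of the first,
   respectively the second, outcome. *)

Implicit Type C : numClosedFieldType.

(** * Adjoints, positivity and the fidelity *)

Lemma adjmxE C m n (A : 'M[C]_(m, n)) i j : adjmx A i j = (A j i)^*.
Proof. by rewrite !mxE. Qed.

Lemma adjmxK C m n (A : 'M[C]_(m, n)) : adjmx (adjmx A) = A.
Proof. by apply/matrixP => i j; rewrite !adjmxE conjCK. Qed.

Lemma adjmxM C m n p (A : 'M[C]_(m, n)) (B : 'M[C]_(n, p)) :
  adjmx (A *m B) = adjmx B *m adjmx A.
Proof. by rewrite /adjmx map_mxM trmx_mul. Qed.

Lemma adjmxD C m n (A B : 'M[C]_(m, n)) : adjmx (A + B) = adjmx A + adjmx B.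
Proof. by rewrite /adjmx map_mxD linearD. Qed.

Lemma adjmxB C m n (A B : 'M[C]_(m, n)) : adjmx (A - B) = adjmx A - adjmx B.
Proof. by rewrite /adjmx map_mxB linearB. Qed.

Lemma adjmxZ C m n (c : C) (A : 'M[C]_(m, n)) : adjmx (c *: A) = c^* *: adjmx A.
Proof. by rewrite /adjmx map_mxZ linearZ. Qed.

Lemma adjmx0 C m n : adjmx (0 : 'M[C]_(m, n)) = 0.
Proof. by rewrite /adjmx map_mx0 trmx0. Qed.

Lemma adjmx1 C n : adjmx (1%:M : 'M[C]_n) = 1%:M.
Proof. by rewrite /adjmx map_mx1 trmx1. Qed.

Lemma adjmx_sum C m n (I : finType) (F : I -> 'M[C]_(m, n)) :
  adjmx (\sum_i F i) = \sum_i adjmx (F i).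
Proof. exact: (big_morph _ (@adjmxD C m n) (adjmx0 C m n)). Qed.

Lemma adjmx_tens C m n p q (A : 'M[C]_(m, n)) (B : 'M[C]_(p, q)) :
  adjmx (A *t B) = adjmx A *t adjmx B.
Proof. by rewrite /adjmx map_mxT trmx_tens. Qed.

Lemma adjmx_mul_diag C m n (A : 'M[C]_(m, n)) i :
  (adjmx A *m A) i i = \sum_j `|A j i| ^+ 2.
Proof. by rewrite mxE; apply: eq_bigr => j _; rewrite adjmxE mulrC -normCK. Qed.

Lemma adjmx_mul_self_ge0 C n (v : 'cV[C]_n) : 0 <= (adjmx v *m v) 0 0.
Proof. by rewrite adjmx_mul_diag sumr_ge0 // => j _; rewrite exprn_ge0. Qed.

Lemma adjmx_mul_self_eq0 C n (v : 'cV[C]_n) : (adjmx v *m v) 0 0 = 0 -> v = 0.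
Proof.
rewrite adjmx_mul_diag => /psumr_eq0P v0; apply/matrixP => i j.
rewrite ord1 mxE; apply/eqP; rewrite -normr_eq0 -sqrf_eq0; apply/eqP/v0 => // k _.
by rewrite exprn_ge0.
Qed.

Lemma psdmx_herm C n (A : 'M[C]_n) : psdmx A -> adjmx A = A.
Proof. by case=> <-. Qed.

Lemma psdmx_gram C m n (X : 'M[C]_(m, n)) : psdmx (X *m adjmx X).
Proof.
split=> [|v]; first by rewrite adjmxM adjmxK.
rewrite mulmxA -mulmxA -{1}(adjmxK X) -adjmxM; exact: adjmx_mul_self_ge0.
Qed.

Lemma psdmx0 C n : psdmx (0 : 'M[C]_n).
Proof. by rewrite -(mul0mx n (adjmx (0 : 'M[C]_n))); apply: psdmx_gram. Qed.

Lemma psdmxD C n (A B : 'M[C]_n) : psdmx A -> psdmx B -> psdmx (A + B).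
Proof.
move=> [hA pA] [hB pB]; split=> [|v]; first by rewrite adjmxD -hA -hB.
by rewrite mulmxDr mulmxDl mxE addr_ge0.
Qed.

Lemma psdmx_sum C n (I : finType) (F : I -> 'M[C]_n) :
  (forall i, psdmx (F i)) -> psdmx (\sum_i F i).
Proof. by move=> pF; apply: big_ind => //; [exact: psdmx0 | exact: psdmxD]. Qed.

Lemma psdmxZ C n (c : C) (A : 'M[C]_n) : 0 <= c -> psdmx A -> psdmx (c *: A).
Proof.
move=> c0 [hA pA]; split=> [|v].
  by rewrite adjmxZ -hA; congr (_ *: _); apply/esym/CrealP; rewrite realE c0.
by rewrite -scalemxAr -scalemxAl mxE mulr_ge0.
Qed.

Lemma psdmx_congr C m n (X : 'M[C]_(m, n)) (A : 'M[C]_n) :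
  psdmx A -> psdmx (X *m A *m adjmx X).
Proof.
move=> [hA pA]; split=> [|v]; first by rewrite !adjmxM adjmxK -hA mulmxA.
by have := pA (adjmx X *m v); rewrite adjmxM adjmxK !mulmxA.
Qed.

Lemma psdmx_diag_ge0 C n (A : 'M[C]_n) i : psdmx A -> 0 <= A i i.
Proof.
case=> _ /(_ (delta_mx i 0)); rewrite /adjmx map_delta_mx trmx_delta.
by rewrite -rowE -colE !mxE.
Qed.

(** * Spectral decompositions, square roots and the fidelity *)

Lemma herm_spectral C n (A : 'M[C]_n) : adjmx A = A ->
  exists (U : 'M[C]_n) (d : 'rV[C]_n),
    [/\ U *m adjmx U = 1%:M, adjmx U *m U = 1%:M,
        A = adjmx U *m diag_mx d *m U & forall i, d 0 i \is Num.real].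
Proof.
move=> hA; pose U := spectralmx A.
have hermA : A \is hermsymmx.
  by apply/is_hermitianmxP; rewrite expr0 scale1r -{1}hA /adjmx map_trmx.
have UU : U *m adjmx U = 1%:M.
  by have /unitarymxP := spectral_unitarymx A; rewrite /adjmx map_trmx.
exists U, (spectral_diag A); split=> //; first exact: mulmx1C.
  have /orthomx_spectralP {1}-> := hermitian_normalmx hermA.
  by rewrite invmx_unitary ?spectral_unitarymx // /adjmx map_trmx.
by move=> i; have /mxOverP := hermitian_spectral_diag_real hermA; apply.
Qed.

Lemma psd_spectral C n (A : 'M[C]_n) : psdmx A ->
  exists (U : 'M[C]_n) (d : 'rV[C]_n),
    [/\ U *m adjmx U = 1%:M, adjmx U *m U = 1%:M,
        A = adjmx U *m diag_mx d *m U & forall i, 0 <= d 0 i].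
Proof.
move=> pA; have [U [d [UU UU' eA _]]] := herm_spectral (psdmx_herm pA).
exists U, d; split=> // i.
have := psdmx_diag_ge0 i (psdmx_congr U pA).
by rewrite eA !mulmxA UU mul1mx -mulmxA UU mulmx1 !mxE eqxx.
Qed.

Lemma diag_mxM C n (d e : 'rV[C]_n) :
  diag_mx d *m diag_mx e = diag_mx (\row_i (d 0 i * e 0 i)).
Proof.
apply/matrixP => i j; rewrite mul_mx_diag !mxE.
by case: eqP => [->|]; rewrite ?mulr0n ?mul0r.
Qed.

Lemma mulmx_conj_unitary C n (U D E : 'M[C]_n) : U *m adjmx U = 1%:M ->
  (adjmx U *m D *m U) *m (adjmx U *m E *m U) = adjmx U *m (D *m E) *m U.
Proof. by move=> UU; rewrite !mulmxA -(mulmxA _ U) UU mulmx1. Qed.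

Lemma psdmx_sqrt_exists C n (A : 'M[C]_n) :
  psdmx A -> exists B : 'M[C]_n, psdmx B /\ B *m B = A.
Proof.
move=> /psd_spectral [U [d [UU UU' -> d0]]].
(* [f] holds fourth roots of the eigenvalues: it writes [diag_mx e] as a Gram matrix, which makes
   the square root psd. *)
pose e := \row_i sqrtC (d 0 i); pose f := \row_i sqrtC (e 0 i).
have e0 i : 0 <= e 0 i by rewrite mxE sqrtC_ge0.
exists (adjmx U *m diag_mx e *m U); split.
  have -> : diag_mx e = diag_mx f *m adjmx (diag_mx f).
    rewrite /adjmx map_diag_mx tr_diag_mx diag_mxM; congr diag_mx.
    apply/rowP => i; rewrite [RHS]mxE [X in _ * X]mxE -normCK.
    by rewrite ger0_norm [f 0 i]mxE ?sqrtCK ?sqrtC_ge0.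
  by rewrite -{2}(adjmxK U); apply: psdmx_congr; apply: psdmx_gram.
rewrite mulmx_conj_unitary // diag_mxM; congr (_ *m diag_mx _ *m _).
by apply/rowP => i; rewrite !mxE -expr2 sqrtCK.
Qed.

Lemma sqrtmP C n (A : 'M[C]_n) :
  psdmx A -> psdmx (sqrtm A) /\ sqrtm A *m sqrtm A = A.
Proof. by move=> /psdmx_sqrt_exists; apply: epsilon_spec. Qed.

(* In eigenbases of N and N', with eigenvalues d and d', the matrix x of X
   satisfies d'_i^2 x_ij = x_ij d_j^2, so both traces equal
   the sum of |x_ij|^2 / d_j (with 1/0 = 0). *)
Lemma trace_sqrt_swap C n (X N N' : 'M[C]_n) :
  psdmx N -> psdmx N' -> N *m N = adjmx X *m X -> N' *m N' = X *m adjmx X ->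
  \tr N = \tr N'.
Proof.
move=> /psd_spectral [U [d [UU UU' -> d0]]].
move=> /psd_spectral [V [e [VV VV' -> e0]]].
rewrite !mulmx_conj_unitary // !diag_mxM => eN eN'.
pose x := V *m X *m adjmx U.
have xx : adjmx x *m x = diag_mx (\row_i (d 0 i * d 0 i)).
  rewrite /x !adjmxM adjmxK !mulmxA -(mulmxA _ (adjmx V)) VV' mulmx1.
  rewrite -(mulmxA U) -eN !mulmxA UU mul1mx -mulmxA UU mulmx1 //.
have xx' : x *m adjmx x = diag_mx (\row_i (e 0 i * e 0 i)).
  rewrite /x !adjmxM adjmxK !mulmxA -(mulmxA _ (adjmx U)) UU' mulmx1.
  rewrite -(mulmxA V) -eN' !mulmxA VV mul1mx -mulmxA VV mulmx1 //.
(* Associativity of x x* x gives x_ij d_j^2 = e_i^2 x_ij; where x_ij is nonzero, the nonnegative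
   numbers d_j and e_i have equal squares. *)
clearbody x; have xde i j : x i j != 0 -> d 0 j = e 0 i.
  move=> xij; have : (x *m (adjmx x *m x)) i j = (x *m adjmx x *m x) i j.
    by rewrite mulmxA.
  rewrite xx xx' mul_mx_diag mul_diag_mx !mxE mulrC => /(mulIf xij)/eqP.
  by rewrite -!expr2 eqrXn2 // => /eqP.
rewrite mxtrace_mulC mulmxA UU mul1mx mxtrace_mulC mulmxA VV mul1mx.
rewrite !mxtrace_diag.
(* Also valid at y = 0, where the inverse is 0 by convention, so zero eigenvalues need no separate
   treatment. *)
have divK (y : C) : y = y * y * y^-1.
  by have [->|y0] := eqVneq y 0; rewrite ?mul0r // mulfK.
have dE j : d 0 j = \sum_i `|x i j| ^+ 2 * (d 0 j)^-1.
  by rewrite -mulr_suml -adjmx_mul_diag xx !mxE eqxx mulr1n -divK.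
have eE i : e 0 i = \sum_j `|x i j| ^+ 2 * (e 0 i)^-1.
  rewrite [LHS]divK -mulr_suml; congr (_ * _).
  transitivity ((adjmx (adjmx x) *m adjmx x) i i).
    by rewrite adjmxK xx' !mxE eqxx.
  by rewrite adjmx_mul_diag; apply: eq_bigr => j _; rewrite adjmxE norm_conjC.
rewrite (eq_bigr _ (fun j _ => dE j)) exchange_big /=; apply: eq_bigr => i _.
rewrite [RHS]eE; apply: eq_bigr => j _.
have [->|/xde -> //] := eqVneq (x i j) 0.
by rewrite normr0 expr0n /= !mul0r.
Qed.

(* As N^2 - Y^2 = N (N - Y) + (N - Y) Y, a unit vector v with (N - Y) v = d v
   satisfies v* (N^2 - Y^2) v = d v* (N + Y) v. *)
Lemma sqrt_trace_mono C n (N Y : 'M[C]_n) :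
  psdmx N -> adjmx Y = Y -> psdmx (N *m N - Y *m Y) -> \tr Y <= \tr N.
Proof.
move=> pN hY [_ pNY]; have hN := psdmx_herm pN.
have hH : adjmx (N - Y) = N - Y by rewrite adjmxB hN hY.
have [U [d [UU UU' eH dR]]] := herm_spectral hH.
rewrite -subr_ge0 -linearB /= eH mxtrace_mulC mulmxA UU mul1mx mxtrace_diag.
apply: sumr_ge0 => i _.
(* If d_i < 0, then v* (N + Y) v <= 0 while v* (N - Y) v = d_i; adding the two gives 2 v* N v < 0,
   against the positivity of N. *)
rewrite real_leNgt ?dR //; apply/negP => di0.
pose v := col i (adjmx U).
have Hv : (N - Y) *m v = d 0 i *: v.
  rewrite /v colE mulmxA eH -(mulmxA _ U) UU mulmx1 -!colE.
  by apply/colP => k; rewrite mxE mul_mx_diag !mxE mulrC.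
have vH : adjmx v *m (N - Y) = d 0 i *: adjmx v.
  by rewrite -{1}hH -adjmxM Hv adjmxZ (CrealP (dR i)).
have vv : (adjmx v *m v) 0 0 = 1.
  have := congr1 (fun M : 'M_n => M i i) UU; rewrite !mxE eqxx mulr1n => <-.
  by apply: eq_bigr => k _; rewrite !mxE conjCK mulrC.
have sqE : N *m N - Y *m Y = N *m (N - Y) + (N - Y) *m Y.
  by rewrite mulmxBr mulmxBl addrA subrK.
have NY0 : 0 <= (adjmx v *m (N + Y) *m v) 0 0 * d 0 i.
  have := pNY v; rewrite sqE.
  have -> : adjmx v *m (N *m (N - Y) + (N - Y) *m Y) *m v
      = d 0 i *: (adjmx v *m (N + Y) *m v).
    rewrite mulmxDr !mulmxA vH mulmxDl -!mulmxA Hv !mulmxA.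
    by rewrite -scalemxAr -!scalemxAl -scalerDr mulmxDr mulmxDl.
  by rewrite mxE mulrC.
rewrite nmulr_lge0 // in NY0.
have NYd : (adjmx v *m N *m v) 0 0 - (adjmx v *m Y *m v) 0 0 = d 0 i.
  have := congr1 (fun M => (adjmx v *m M) 0 0) Hv.
  rewrite -scalemxAr [in RHS]mxE vv mulr1 => <-.
  by rewrite mulmxBl mulmxBr !mulmxA !mxE.
have [_ /(_ v) Nv] := pN.
have : (adjmx v *m N *m v) 0 0 *+ 2 < 0.
  have -> : (adjmx v *m N *m v) 0 0 *+ 2 = (adjmx v *m (N + Y) *m v) 0 0 + d 0 i.
    by rewrite -NYd mulmxDr mulmxDl [X in X + _]mxE addrACA subrr addr0.
  by rewrite (le_lt_trans _ di0) // gerDr.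
by rewrite pmulrn_llt0 // le_gtF.
Qed.

(** With r and q the square roots of rho and s, swapping the factors of r q turns the fidelity into
    the trace of the square root of r s r. Since r s r - (r B r)^2 = r (s - B rho B) r is psd,
    monotonicity bounds it below by tr(r B r) = tr(B rho). B only has to be Hermitian, because
    [sqrt_trace_mono] asks no more of its smaller matrix. *)
Lemma fidelity_ge_trace C n (s rho B : 'M[C]_n) :
  psdmx rho -> adjmx B = B -> psdmx (s - B *m rho *m B) ->
  \tr (B *m rho) <= fidelity s rho.
Proof.
move=> prho hB psB.
have ps : psdmx s.
  rewrite -(subrK (B *m rho *m B) s); apply: psdmxD => //.
  by rewrite -{2}hB; apply: psdmx_congr.
have [pr er] := sqrtmP prho; have [pq eq] := sqrtmP ps.
rewrite /fidelity; set r := sqrtm rho in pr er *; set q := sqrtm s in pq eq *.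
have hr := psdmx_herm pr; have hq := psdmx_herm pq.
have pqr : psdmx (q *m rho *m q) by rewrite -{2}hq; apply: psdmx_congr.
have prq : psdmx (r *m s *m r) by rewrite -{2}hr; apply: psdmx_congr.
have [pN eN] := sqrtmP pqr; have [pN' eN'] := sqrtmP prq.
rewrite (@trace_sqrt_swap _ _ (r *m q) _ (sqrtm (r *m s *m r))) //; first last.
- by rewrite eN' adjmxM hr hq -{1}eq !mulmxA.
- by rewrite eN adjmxM hr hq -{1}er !mulmxA.
rewrite -er mulmxA mxtrace_mulC mulmxA.
apply: sqrt_trace_mono => //; first by rewrite !adjmxM hr hB mulmxA.
rewrite eN'.
have -> : r *m s *m r - r *m B *m r *m (r *m B *m r)
    = r *m (s - B *m rho *m B) *m adjmx r.
  by rewrite hr -er mulmxBr mulmxBl !mulmxA.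
exact: psdmx_congr.
Qed.

(** * Single-qubit operators on the register *)

(** Induction on T, removing the lowest bit by halving. *)
Lemma bits_inj T (i j : nat) : (i < 2 ^ T)%N -> (j < 2 ^ T)%N ->
  (forall t, (t < T)%N -> odd (i %/ 2 ^ t) = odd (j %/ 2 ^ t)) -> i = j.
Proof.
elim: T i j => [|T IH] i j; first by rewrite expn0 !ltnS !leqn0 => /eqP-> /eqP->.
move=> iT jT ij; rewrite -(odd_double_half i) -(odd_double_half j).
congr (_ + _.*2)%N; first by have := ij 0 isT; rewrite expn0 !divn1 => ->.
apply: IH => [||t tT]; rewrite -!divn2 ?ltn_divLR // -?expnSr //.
by rewrite -!divnMA -expnS; apply: ij.
Qed.

Lemma qbit_inj T (i j : 'I_(2 ^ T)) : (forall t, qbit t i = qbit t j) -> i = j.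
Proof.
move=> ij; apply: val_inj; apply: (@bits_inj T); rewrite ?ltn_ord // => t tT.
have := congr1 (@nat_of_ord 2) (ij (Ordinal tT)).
by rewrite !inordK /=; do 2![case: odd].
Qed.

Lemma qbits_bij T : bijective (fun i : 'I_(2 ^ T) => [ffun t => qbit t i]).
Proof.
apply: inj_card_bij; last by rewrite card_ffun !card_ord.
by move=> i j /ffunP ij; apply: qbit_inj => t; have := ij t; rewrite !ffunE.
Qed.

(** Every bit string comes from an index by [qbits_bij]. The sigma type provides the updated index
    as a term that can appear in sums. *)
Lemma qbit_update T (t : 'I_T) (i : 'I_(2 ^ T)) (b : 'I_2) :
  {j | forall s, qbit s j = if s == t then b else qbit s i}.
Proof.
pose f := [ffun s => if s == t then b else qbit s i].
have /sigW [j /eqP jf] : exists j : 'I_(2 ^ T), [ffun s => qbit s j] == f.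
  by have [g _ gK] := qbits_bij T; exists (g f); rewrite gK eqxx.
by exists j => s; have /ffunP/(_ s) := jf; rewrite !ffunE.
Qed.

Lemma sum_qbit_update C T (t : 'I_T) (i : 'I_(2 ^ T)) (F : 'I_(2 ^ T) -> C) :
  \sum_(j | [forall s, (s != t) ==> (qbit s i == qbit s j)]) F j
  = \sum_b F (sval (qbit_update t i b)).
Proof.
rewrite (reindex_onto (fun b => sval (qbit_update t i b)) (qbit t)).
  apply: eq_bigl => b; case: qbit_update => j /= jE.
  rewrite jE !eqxx andbT; apply/forallP => s.
  by apply/implyP => /negPf st; rewrite jE st.
move=> j /forallP ij; apply: qbit_inj => s; case: qbit_update => k /= ->.
by case: eqP => [->|/eqP st] //; apply/eqP/(implyP (ij s)).
Qed.

(** A one-qubit operator only links indices that agree off qubit t, so the sum over 2^T indices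
    collapses to one over a single bit. *)
Lemma embed1_mul_entry C T (t : 'I_T) (A : 'M[C]_2) (X : 'M[C]_(2 ^ T)) i k :
  (embed1 t A *m X) i k
  = \sum_b A (qbit t i) b * X (sval (qbit_update t i b)) k.
Proof.
rewrite mxE.
transitivity (\sum_(j | [forall s, (s != t) ==> (qbit s i == qbit s j)])
    A (qbit t i) (qbit t j) * X j k).
  rewrite [RHS]big_mkcond; apply: eq_bigr => j _; rewrite mxE.
  by case: ifP; rewrite ?mulr1 // mulr0 mul0r.
rewrite sum_qbit_update; apply: eq_bigr => b _.
by case: qbit_update => j /= ->; rewrite eqxx.
Qed.

Lemma embed1M C T (t : 'I_T) (A B : 'M[C]_2) :
  embed1 t A *m embed1 t B = embed1 t (A *m B).
Proof.
apply/matrixP => i k; rewrite embed1_mul_entry !mxE mulr_suml.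
apply: eq_bigr => b _; case: qbit_update => j /= jE.
rewrite !mxE jE eqxx mulrA; congr (_ * _%:R); congr (nat_of_bool _).
by apply: eq_forallb => s; rewrite jE; case: eqP.
Qed.

Lemma embed1C C T (t s : 'I_T) (A B : 'M[C]_2) : s != t ->
  embed1 t A *m embed1 s B = embed1 s B *m embed1 t A.
Proof.
move=> st.
(* This entry formula is symmetric under exchanging (u, Y) with (v, X), so it settles both orders of
   multiplication. *)
have comm (u v : 'I_T) (X Y : 'M[C]_2) i k : u != v ->
  (embed1 v X *m embed1 u Y) i k = X (qbit v i) (qbit v k)
   * Y (qbit u i) (qbit u k)
   * [forall w, (w != u) && (w != v) ==> (qbit w i == qbit w k)]%:R.
  (* Only b equal to bit v of k survives: the second factor acts on qubit u alone and forces
     agreement on qubit v. *)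
  move=> uv; rewrite embed1_mul_entry (bigD1 (qbit v k)) //= big1 => [|b bk].
    case: qbit_update => j /= jE; rewrite addr0 mxE jE (negPf uv) mulrA.
    congr (_ * _%:R); congr (nat_of_bool _); apply: eq_forallb => w.
    rewrite jE; have [->|] := eqVneq w v; last by rewrite andbT.
    by rewrite eqxx andbF implybT.
  case: qbit_update => j /= jE; rewrite mxE.
  suff -> : [forall w, (w != u) ==> (qbit w j == qbit w k)] = false.
    by rewrite !mulr0.
  apply/negbTE/forallPn; exists v; rewrite eq_sym uv /= jE eqxx //.
apply/matrixP => i k; rewrite comm // comm; last by rewrite eq_sym.
rewrite [A _ _ * _]mulrC; congr (_ * _%:R); congr (nat_of_bool _).
by apply: eq_forallb => w; rewrite andbC.
Qed.

Lemma embed1D C T (t : 'I_T) (A B : 'M[C]_2) :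
  embed1 t (A + B) = embed1 t A + embed1 t B.
Proof. by apply/matrixP => i j; rewrite !mxE mulrDl. Qed.

Lemma embed1B C T (t : 'I_T) (A B : 'M[C]_2) :
  embed1 t (A - B) = embed1 t A - embed1 t B.
Proof. by apply/matrixP => i j; rewrite !mxE mulrBl. Qed.

Lemma embed1Z C T (t : 'I_T) c (A : 'M[C]_2) :
  embed1 t (c *: A) = c *: embed1 t A.
Proof. by apply/matrixP => i j; rewrite !mxE mulrA. Qed.

Lemma embed1_1 C T (t : 'I_T) : embed1 t (1%:M : 'M[C]_2) = 1%:M.
Proof.
apply/matrixP => i j; rewrite !mxE -natrM mulnb; congr (nat_of_bool _)%:R.
apply/andP/eqP => [[/eqP ijt /forallP ij]|-> ]; last first.
  by split=> //; apply/forallP => s; rewrite eqxx implybT.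
apply: qbit_inj => s; have [-> //|st] := eqVneq s t.
by apply/eqP; move: (ij s); rewrite st.
Qed.

Lemma adjmx_embed1 C T (t : 'I_T) (A : 'M[C]_2) :
  adjmx (embed1 t A) = embed1 t (adjmx A).
Proof.
apply/matrixP => i j; rewrite adjmxE !mxE rmorphM /= conjC_nat.
congr (_ * _%:R); congr (nat_of_bool _); apply: eq_forallb => s.
by congr (_ ==> _); apply: eq_sym.
Qed.

(** * Partial trace *)

(** The isometry |a> (x) I from the system into register and system; the partial trace is the sum of
    the compressions by these maps, which makes its positivity immediate. *)
Definition slice C T n (a : 'I_(2 ^ T)) : 'M[C]_(2 ^ T * n, n) :=
  \matrix_(k, s) (k == mxtens_index (a, s))%:R.

Lemma adj_slice_mul C T n p a (Z : 'M[C]_(2 ^ T * n, p)) s j :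
  (adjmx (slice C n a) *m Z) s j = Z (mxtens_index (a, s)) j.
Proof.
rewrite mxE (bigD1 (mxtens_index (a, s))) //= big1 ?addr0 => [|k /negPf ks].
  by rewrite adjmxE mxE eqxx conjC1 mul1r.
by rewrite adjmxE mxE ks conjC0 mul0r.
Qed.

Lemma mul_sliceE C T n p a (Z : 'M[C]_(p, 2 ^ T * n)) i s :
  (Z *m slice C n a) i s = Z i (mxtens_index (a, s)).
Proof.
by rewrite -[LHS]conjCK -adjmxE adjmxM adj_slice_mul adjmxE conjCK.
Qed.

Lemma ptraceE C T n (Z : 'M[C]_(2 ^ T * n)) :
  ptrace Z = \sum_a adjmx (slice C n a) *m Z *m slice C n a.
Proof.
apply/matrixP => i j; rewrite mxE summxE; apply: eq_bigr => a _.
by rewrite mul_sliceE adj_slice_mul.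
Qed.

Lemma psdmx_ptrace C T n (Z : 'M[C]_(2 ^ T * n)) : psdmx Z -> psdmx (ptrace Z).
Proof.
move=> pZ; rewrite ptraceE; apply: psdmx_sum => a.
by rewrite -{2}(adjmxK (slice C n a)); apply: psdmx_congr.
Qed.

Lemma ptraceD C T n (X Y : 'M[C]_(2 ^ T * n)) :
  ptrace (X + Y) = ptrace X + ptrace Y.
Proof.
apply/matrixP => i j; rewrite !mxE -big_split /=.
by apply: eq_bigr => a _; rewrite mxE.
Qed.

Lemma ptraceB C T n (X Y : 'M[C]_(2 ^ T * n)) :
  ptrace (X - Y) = ptrace X - ptrace Y.
Proof. by apply: (addIr (ptrace Y)); rewrite -ptraceD !subrK. Qed.

Lemma adj_slice_tens C T n (A : 'M[C]_(2 ^ T)) a :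
  adjmx (slice C n a) *m (A *t 1%:M) = \sum_b A a b *: adjmx (slice C n b).
Proof.
apply/matrixP => s k; rewrite adj_slice_mul summxE.
case: (mxtens_indexP k) => c s'; rewrite tensmxE (bigD1 c) //= big1 ?addr0.
  rewrite !mxE (inj_eq (can_inj (@mxtens_indexK _ _))).
  by rewrite xpair_eqE eqxx conjC_nat eq_sym.
move=> b bc; rewrite !mxE (inj_eq (can_inj (@mxtens_indexK _ _))).
by rewrite xpair_eqE eq_sym (negPf bc) conjC0 mulr0.
Qed.

Lemma tens_slice C T n (A : 'M[C]_(2 ^ T)) a :
  (A *t 1%:M) *m slice C n a = \sum_b A b a *: slice C n b.
Proof.
rewrite -[LHS]adjmxK adjmxM adjmx_tens adjmx1 adj_slice_tens adjmx_sum.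
by apply: eq_bigr => b _; rewrite adjmxZ adjmxE adjmxK conjCK.
Qed.

(** Moving A through the slices turns both sides into the same double sum of A_ab <b| Z |a>. *)
Lemma ptrace_cyclic C T n (A : 'M[C]_(2 ^ T)) (Z : 'M[C]_(2 ^ T * n)) :
  ptrace ((A *t 1%:M) *m Z) = ptrace (Z *m (A *t 1%:M)).
Proof.
rewrite !ptraceE.
under eq_bigr do rewrite mulmxA adj_slice_tens 2!mulmx_suml.
under [RHS]eq_bigr do rewrite -!mulmxA tens_slice 2!mulmx_sumr.
rewrite exchange_big /=; apply: eq_bigr => b _; apply: eq_bigr => a _.
by rewrite -!scalemxAl -!scalemxAr mulmxA.
Qed.

Lemma ptrace_tens C T n (A : 'M[C]_(2 ^ T)) (X : 'M[C]_n) :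
  ptrace (A *t X) = \tr A *: X.
Proof.
apply/matrixP => i j; rewrite !mxE mulr_suml.
by apply: eq_bigr => a _; rewrite tensmxE.
Qed.

Lemma tensmxDr C m n p q (A : 'M[C]_(m, n)) (X Y : 'M[C]_(p, q)) :
  A *t (X + Y) = A *t X + A *t Y.
Proof. by apply/matrixP => i j; rewrite !mxE mulrDr. Qed.

Lemma tensmxBr C m n p q (A : 'M[C]_(m, n)) (X Y : 'M[C]_(p, q)) :
  A *t (X - Y) = A *t X - A *t Y.
Proof. by apply/matrixP => i j; rewrite !mxE mulrBr. Qed.

Lemma tensmxBl C m n p q (A B : 'M[C]_(m, n)) (X : 'M[C]_(p, q)) :
  (A - B) *t X = A *t X - B *t X.
Proof. by apply/matrixP => i j; rewrite !mxE mulrBl. Qed.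

Lemma tensmxDl C m n p q (A B : 'M[C]_(m, n)) (X : 'M[C]_(p, q)) :
  (A + B) *t X = A *t X + B *t X.
Proof. by apply/matrixP => i j; rewrite !mxE mulrDl. Qed.

Lemma tensmxZl C m n p q c (A : 'M[C]_(m, n)) (X : 'M[C]_(p, q)) :
  (c *: A) *t X = A *t (c *: X).
Proof. by apply/matrixP => i j; rewrite !mxE mulrCA mulrA. Qed.

Lemma tensmx11 C m n : (1%:M : 'M[C]_m) *t (1%:M : 'M[C]_n) = 1%:M.
Proof.
apply/matrixP => i j; case: (mxtens_indexP i) => a s.
case: (mxtens_indexP j) => b s'.
rewrite tensmxE !mxE (inj_eq (can_inj (@mxtens_indexK _ _))) xpair_eqE.
by rewrite -natrM mulnb.
Qed.

(* With M = P (x) 1, the blocks M Z (1 - M) and (1 - M) Z M have zero partial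
   trace, by cyclicity in the environment. *)
Lemma ptrace_compress C T n (P : 'M[C]_(2 ^ T)) (G : 'M[C]_(2 ^ T * n))
    (B rho : 'M[C]_n) :
  adjmx P = P -> P *m P = P -> \tr P = 1 -> psdmx rho ->
  (P *t 1%:M) *m G *m (P *t 1%:M) = P *t B ->
  psdmx (ptrace (G *m (P *t rho) *m adjmx G) - B *m rho *m adjmx B).
Proof.
move=> hP PP trP prho; set M := P *t 1%:M => eG.
have hM : adjmx M = M by rewrite adjmx_tens hP adjmx1.
have MM : M *m M = M by rewrite tensmx_mul PP mulmx1.
set Z := G *m _ *m _.
have pZ : psdmx Z.
  have [pr er] := sqrtmP prho; apply: psdmx_congr.
  have -> : P *t rho = (P *t sqrtm rho) *m adjmx (P *t sqrtm rho).
    by rewrite adjmx_tens hP (psdmx_herm pr) tensmx_mul PP er.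
  exact: psdmx_gram.
have MZM : ptrace (M *m Z *m M) = B *m rho *m adjmx B.
  have -> : M *m Z *m M = (P *t B) *m (P *t rho) *m adjmx (P *t B).
    have eP : P *t rho = M *m (P *t rho) *m M.
      by rewrite !tensmx_mul !PP mul1mx mulmx1.
    by rewrite -eG /Z {1}eP !adjmxM hM !mulmxA.
  by rewrite adjmx_tens hP !tensmx_mul !PP ptrace_tens trP scale1r.
clearbody Z; have eN : 1%:M - M = (1%:M - P) *t 1%:M.
  by rewrite tensmxBl tensmx11.
have NN : (1%:M - M) *m (1%:M - M) = 1%:M - M.
  by rewrite mulmxBr mulmx1 mulmxBl mul1mx MM subrr subr0.
(* The cross blocks drop out, so the difference is the partial trace of the remaining diagonal
   block, which is psd. *)
have <- : ptrace ((1%:M - M) *m Z *m adjmx (1%:M - M))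
    = ptrace Z - B *m rho *m adjmx B.
  rewrite adjmxB adjmx1 hM -MZM -!mulmxA {1}eN !ptrace_cyclic -eN -!mulmxA.
  by rewrite NN MM mulmxBr mulmx1 ptraceB.
by apply: psdmx_ptrace; apply: psdmx_congr.
Qed.

(** * Controlled reflections *)

Lemma proj2E C (v : 'cV[C]_2) i j : proj2 v i j = v i 0 * (v j 0)^*.
Proof. by rewrite mxE big_ord1 adjmxE. Qed.

Lemma proj2_ketmE C i j : proj2 (ketm C) i j = 2%:R^-1 * (-1) ^+ (i != j).
Proof.
have ketE k : ketm C k 0 = (sqrtC 2%:R)^-1 * (-1) ^+ (k != 0).
  by rewrite !mxE; case: k => [[|[|m]] km] //=; rewrite ?subr0 ?sub0r.
rewrite proj2E !ketE rmorphM rmorphXn rmorphN1 fmorphV /=.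
rewrite (CrealP (sqrtC_real _)) ?ler0n // mulrACA -invfM -expr2 sqrtCK.
congr (_ * _); rewrite -signr_addb; congr (_ ^+ nat_of_bool _).
by case: i j => [[|[|m]] ?] [[|[|p]] ?].
Qed.

Lemma proj2_adj C (v : 'cV[C]_2) : adjmx (proj2 v) = proj2 v.
Proof. by rewrite adjmxM adjmxK. Qed.

Lemma proj2_ket01 C : proj2 (ket0 C) + proj2 (ket1 C) = 1%:M.
Proof.
apply/matrixP => i j; rewrite mxE !proj2E !mxE !conjC_nat.
by case: i j => [[|[|m]] ?] [[|[|p]] ?]; rewrite //= ?mulr0 ?mulr1 ?addr0 ?add0r.
Qed.

Lemma proj2_ket1_idem C : proj2 (ket1 C) *m proj2 (ket1 C) = proj2 (ket1 C).
Proof.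
apply/matrixP => i j; rewrite mxE !big_ord_recl big_ord0 !proj2E !mxE !conjC_nat.
by rewrite /= !mulr0 mul0r add0r addr0 mulr1 mul1r.
Qed.

Lemma proj2_ketm_idem C : proj2 (ketm C) *m proj2 (ketm C) = proj2 (ketm C).
Proof.
apply/matrixP => i j; rewrite mxE !big_ord_recl big_ord0 !proj2_ketmE.
by case: i j => [[|[|m]] ?] [[|[|p]] ?] //=; field.
Qed.

(** The scalar is the squared overlap of |1> and |->. It cancels the 2 in I - 2 |phi><phi|, which is
    why the compressed reflection becomes a projector. *)
Lemma proj2_ketm_ket1 C :
  proj2 (ketm C) *m proj2 (ket1 C) *m proj2 (ketm C) = 2%:R^-1 *: proj2 (ketm C).
Proof.
apply/matrixP => i j.
rewrite mxE !big_ord_recl big_ord0 [RHS]mxE.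
rewrite [X in X * _ + _]mxE [X in _ + (X * _ + _)]mxE.
rewrite !big_ord_recl !big_ord0 !proj2_ketmE !proj2E !mxE !conjC_nat.
by case: i j => [[|[|m]] ?] [[|[|p]] ?] //=; field.
Qed.

Lemma adjmx_refl C n (v : 'cV[C]_n) : adjmx (refl v) = refl v.
Proof. by rewrite adjmxB adjmx1 adjmxZ adjmxM adjmxK conjC_nat. Qed.

Lemma refl_involutive C n (v : 'cV[C]_n) :
  adjmx v *m v = 1%:M -> refl v *m refl v = 1%:M.
Proof.
move=> vv; rewrite /refl; set p := v *m _.
have pp : p *m p = p by rewrite /p mulmxA -(mulmxA v) vv mulmx1.
rewrite mulmxBl mul1mx mulmxBr mulmx1 -scalemxAl -scalemxAr pp.
rewrite !scaler_nat; set a := _ *+ 2; by rewrite [a *+ 2]mulr2n opprB addrK subrK.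
Qed.

Lemma ket1_norm C : adjmx (ket1 C) *m ket1 C = 1%:M.
Proof.
apply/matrixP => i j; rewrite !ord1 mxE !big_ord_recl big_ord0 !mxE !conjC_nat.
by rewrite /= mul0r add0r addr0 mulr1.
Qed.

(* The Pauli Z operator exchanges |-> and |+>. *)
Lemma proj2_ketm_flip C :
  refl (ket1 C) *m proj2 (ketm C) *m refl (ket1 C) = 1%:M - proj2 (ketm C).
Proof.
have -> : refl (ket1 C) = diag_mx (\row_k (-1) ^+ k).
  apply/matrixP => i j; rewrite !mxE big_ord1 !mxE conjC_nat.
  case: i j => [[|[|m]] ?] [[|[|p]] ?] //=;
    by rewrite ?mulr0n ?mulr0 ?mulr1n; ring.
apply/matrixP => i j.
rewrite mul_mx_diag mxE mul_diag_mx mxE proj2_ketmE 2!mxE.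
rewrite [RHS]mxE [X in _ = _ + X]mxE proj2_ketmE [X in _ = X + _]mxE.
by case: i j => [[|[|m]] ?] [[|[|p]] ?] //=; rewrite ?mulr1n ?mulr0n; field.
Qed.

(** * The register projector onto |-> on every qubit *)

Definition ketm_proj C T (t : 'I_T) : 'M[C]_(2 ^ T) :=
  embed1 t (proj2 (ketm C)).

Lemma ketm_proj_idem C T (t : 'I_T) :
  ketm_proj C t *m ketm_proj C t = ketm_proj C t.
Proof. by rewrite embed1M proj2_ketm_idem. Qed.

Lemma ketm_proj_comm C T (s t : 'I_T) :
  GRing.comm (ketm_proj C s) (ketm_proj C t).
Proof.
by have [->|st] := eqVneq t s; [apply: GRing.commr_refl | apply: embed1C].
Qed.

Lemma minusT_absorbl C T (t : 'I_T) : ketm_proj C t *m minusT C T = minusT C T.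
Proof.
have absorb s : t \in s ->
  ketm_proj C t *m \prod_(i <- s) ketm_proj C i = \prod_(i <- s) ketm_proj C i.
  elim: s => // i s IH; rewrite in_cons big_cons => /orP [/eqP <-|/IH {2}<-].
    by rewrite -[_ * _]/(_ *m _) mulmxA ketm_proj_idem.
  by rewrite -!/(_ * _) !mulrA (ketm_proj_comm C t i).
by apply: absorb; rewrite mem_index_enum.
Qed.

Lemma minusT_absorbr C T (t : 'I_T) : minusT C T *m ketm_proj C t = minusT C T.
Proof.
rewrite -[RHS](minusT_absorbl C t); apply/esym.
by apply: GRing.Theory.commr_prod => s _; apply: ketm_proj_comm.
Qed.

Lemma minusT_idem C T : minusT C T *m minusT C T = minusT C T.
Proof.
rewrite {1}/minusT.
elim: (index_enum _) => [|t s IH]; first by rewrite big_nil mul1mx.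
by rewrite big_cons -[_ * _]/(_ *m _) -mulmxA IH minusT_absorbl.
Qed.

Lemma adjmx_minusT C T : adjmx (minusT C T) = minusT C T.
Proof.
rewrite /minusT; elim: (index_enum _) => [|t s IH].
  by rewrite !big_nil -[1]/(1%:M) adjmx1.
rewrite big_cons -[_ * _]/(_ *m _) adjmxM IH adjmx_embed1 proj2_adj.
by apply/esym; apply: GRing.Theory.commr_prod => i _; apply: ketm_proj_comm.
Qed.

(** Each factor halves the trace: conjugation by Pauli Z on qubit t exchanges [ketm_proj C t] with
    its complement and fixes the factors on other qubits, so both choices have the same trace.
    Starting from the identity, of trace 2^T, T halvings leave 1. *)
Lemma minusT_trace C T : \tr (minusT C T) = 1.
Proof.
have trs (s : seq 'I_T) : uniq s ->
    \tr (\prod_(t <- s) ketm_proj C t) * 2%:R ^+ size s = (2 ^ T)%:R.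
  elim: s => [|t s IH]; first by rewrite big_nil mxtrace1 mulr1.
  rewrite cons_uniq => /andP [ts /IH <-]; rewrite big_cons exprS mulrA.
  congr (_ * _); set W := \prod_(i <- s) _.
  have ZZ := refl_involutive (ket1_norm C); have ZpZ := proj2_ketm_flip C.
  set Z := refl _ in ZZ ZpZ.
  have ZW : embed1 t Z *m W = W *m embed1 t Z.
    rewrite /W big_seq; apply: GRing.Theory.commr_prod => i si.
    by apply: embed1C; apply: contraNneq ts => <-.
  have tr2 : \tr (ketm_proj C t *m W) = \tr W - \tr (ketm_proj C t *m W).
    rewrite -{1}(mul1mx (_ *m W)) -(embed1_1 C t) -ZZ -embed1M -mulmxA.
    rewrite mxtrace_mulC -!mulmxA -ZW !mulmxA !embed1M ZpZ.
    by rewrite -linearB -{2}(mul1mx W) -mulmxBl -(embed1_1 C t) embed1B.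
  by rewrite mulr_natr mulr2n {2}tr2 addrC subrK.
have szT : size (index_enum 'I_T) = T.
  by rewrite -sum1_size sum1_card card_ord.
have /= := trs _ (index_enum_uniq _); rewrite szT natrX -[RHS]mul1r.
by apply: mulIf; rewrite expf_neq0 // pnatr_eq0.
Qed.

Lemma adjmx_prod_rev C N T (F : 'I_T -> 'M[C]_N) :
  adjmx (\prod_(t < T) F t) = \prod_(t < T) adjmx (F (rev_ord t)).
Proof.
elim: T F => [|T IH] F; first by rewrite !big_ord0; apply: adjmx1.
rewrite big_ord_recl big_ord_recr /= adjmxM IH; congr (_ *m adjmx (F _)).
  apply: eq_bigr => t _; congr (adjmx (F _)); apply: val_inj.
  by rewrite /= /bump subSn.
by apply: val_inj; rewrite /= subnn.
Qed.

(** The operator Q_k of the overview, for v = phi_k. *)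
Definition miss_proj C n (v : 'cV[C]_n) : 'M[C]_n := 1%:M - v *m adjmx v.

Lemma adjmx_miss_proj C n (v : 'cV[C]_n) : adjmx (miss_proj v) = miss_proj v.
Proof. by rewrite adjmxB adjmx1 adjmxM adjmxK. Qed.

Lemma miss_proj_idem C n (v : 'cV[C]_n) :
  adjmx v *m v = 1%:M -> miss_proj v *m miss_proj v = miss_proj v.
Proof.
move=> vv; rewrite mulmxBr mulmx1 mulmxBl mul1mx mulmxA -(mulmxA v) vv mulmx1.
by rewrite subrr subr0.
Qed.

Lemma adjmx_ctrl_refl C T n (t : 'I_T) (v : 'cV[C]_n) :
  adjmx (ctrl_refl t v) = ctrl_refl t v.
Proof.
by rewrite adjmxD !adjmx_tens !adjmx_embed1 !proj2_adj adjmx_refl adjmx1.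
Qed.

Lemma ctrl_reflE C T n (t : 'I_T) (v : 'cV[C]_n) :
  ctrl_refl t v = 1%:M - embed1 t (proj2 (ket1 C)) *t (2%:R *: (v *m adjmx v)).
Proof.
rewrite /ctrl_refl /refl tensmxBr addrA -tensmxDl -embed1D proj2_ket01.
by rewrite embed1_1 tensmx11.
Qed.

Lemma ctrl_refl_involutive C T n (t : 'I_T) (v : 'cV[C]_n) :
  adjmx v *m v = 1%:M -> ctrl_refl t v *m ctrl_refl t v = 1%:M.
Proof.
move=> vv; rewrite ctrl_reflE; set w := 2%:R *: _.
have ww : w *m w = w + w.
  rewrite -scalemxAl -scalemxAr mulmxA -(mulmxA v) vv mulmx1.
  by rewrite -/w scaler_nat mulr2n.
rewrite mulmxBl mul1mx mulmxBr mulmx1 tensmx_mul embed1M proj2_ket1_idem ww.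
by rewrite tensmxDr opprB addrK subrK.
Qed.

Lemma ketm_proj_ctrl_refl C T n (t : 'I_T) (v : 'cV[C]_n) :
  (ketm_proj C t *t 1%:M) *m ctrl_refl t v *m (ketm_proj C t *t 1%:M)
  = (1%:M *t miss_proj v) *m (ketm_proj C t *t 1%:M).
Proof.
rewrite ctrl_reflE mulmxBr mulmx1 mulmxBl !tensmx_mul ketm_proj_idem !embed1M.
rewrite proj2_ketm_ket1 embed1Z tensmxZl mulmx1 !mul1mx mulmx1 -tensmxBr.
by rewrite mulmx1 scalerA mulVf ?pnatr_eq0 // scale1r.
Qed.

Lemma ketm_proj_ctrl_comm C T n (s t : 'I_T) (v : 'cV[C]_n) : s != t ->
  (ketm_proj C t *t 1%:M) *m ctrl_refl s v
  = ctrl_refl s v *m (ketm_proj C t *t 1%:M).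
Proof.
move=> st; rewrite ctrl_reflE mulmxBr mulmxBl mul1mx mulmx1 !tensmx_mul.
by rewrite (embed1C _ _ st) mul1mx mulmx1.
Qed.

Lemma Mfirst_idem C n T : Mfirst C n T *m Mfirst C n T = Mfirst C n T.
Proof. by rewrite tensmx_mul minusT_idem mulmx1. Qed.

Lemma adjmx_Mfirst C n T : adjmx (Mfirst C n T) = Mfirst C n T.
Proof. by rewrite adjmx_tens adjmx_minusT adjmx1. Qed.

(** Induction on the list. Each outer projector can give off a copy of [p], the projector of the
    head qubit; as the remaining reflections act on other qubits, the right copy moves past them,
    and the head reflection is compressed between the two copies to [miss_proj]. *)
Lemma Mfirst_prod_ctrl C n T (v : 'I_T -> 'cV[C]_n) (s : seq 'I_T) : uniq s ->
  Mfirst C n T *m \prod_(t <- s) ctrl_refl t (v t) *m Mfirst C n T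
  = minusT C T *t \prod_(t <- s) miss_proj (v t).
Proof.
elim: s => [|t s IH]; first by rewrite !big_nil mulmx1 Mfirst_idem.
rewrite cons_uniq => /andP [ts us]; rewrite !big_cons.
rewrite -[_ * _ in LHS]/(_ *m _) -[_ * _ in RHS]/(_ *m _).
set W := \prod_(i <- s) ctrl_refl _ _ in IH *.
set p := ketm_proj C t *t (1%:M : 'M[C]_n).
have Mp : Mfirst C n T *m p = Mfirst C n T.
  by rewrite tensmx_mul minusT_absorbr mulmx1.
have pM : p *m Mfirst C n T = Mfirst C n T.
  by rewrite tensmx_mul minusT_absorbl mulmx1.
have pW : p *m W = W *m p.
  rewrite /W big_seq; apply: GRing.Theory.commr_prod => i si.
  by apply: ketm_proj_ctrl_comm; apply: contraNneq ts => <-.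
rewrite -{1}Mp -{2}pM !mulmxA -(mulmxA _ W) -pW !mulmxA.
rewrite -2!(mulmxA (Mfirst _ _ _)).
rewrite ketm_proj_ctrl_refl mulmxA.
have -> : Mfirst C n T *m (1%:M *t miss_proj (v t))
    = (1%:M *t miss_proj (v t)) *m Mfirst C n T.
  by rewrite !tensmx_mul !mulmx1 !mul1mx.
rewrite -(mulmxA (1%:M *t _)) Mp -!mulmxA (mulmxA (Mfirst _ _ _)) IH // ?us //.
by rewrite tensmx_mul mul1mx.
Qed.

(** * Outcome probabilities and final state for a given sequence of reflections *)

Section Procedure.
Variables (C : numClosedFieldType) (n K T : nat) (phi : 'I_K -> 'cV[C]_n).
Hypothesis phi_unit : forall k, adjmx (phi k) *m phi k = 1%:M.

Local Notation P := (minusT C T).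
Local Notation M1 := (Mfirst C n T).
Local Notation M2 := (Msecond C n T).
Implicit Types (ks : {ffun 'I_T -> 'I_K}) (rho : 'M[C]_n).

(** The operator S of the overview; [rev_ord] puts the factor of k_1 rightmost, so that it acts
    first. *)
Definition missT (ks : {ffun 'I_T -> 'I_K}) : 'M[C]_n :=
  \prod_(t < T) miss_proj (phi (ks (rev_ord t))).

Lemma adjmx_U_bwd ks : adjmx (U_bwd phi ks) = U_fwd phi ks.
Proof.
by rewrite adjmx_prod_rev; apply: eq_bigr => t _; rewrite adjmx_ctrl_refl.
Qed.

Lemma adjmx_U_fwd ks : adjmx (U_fwd phi ks) = U_bwd phi ks.
Proof. by rewrite -adjmx_U_bwd adjmxK. Qed.

Lemma U_bwd_fwd ks : U_bwd phi ks *m U_fwd phi ks = 1%:M.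
Proof.
rewrite -adjmx_U_bwd; apply: (big_ind (fun X => X *m adjmx X = 1%:M)).
- by rewrite mul1mx; apply: adjmx1.
- move=> X Y XX YY; rewrite -[X * Y]/(X *m Y) adjmxM mulmxA -(mulmxA X) YY.
  by rewrite mulmx1.
- by move=> t _; rewrite adjmx_ctrl_refl ctrl_refl_involutive.
Qed.

Lemma Mfirst_U_fwd ks :
  M1 *m U_fwd phi ks *m M1 = P *t missT ks.
Proof.
pose s := [seq rev_ord t | t <- index_enum 'I_T].
have us : uniq s by rewrite map_inj_uniq ?index_enum_uniq //; apply: rev_ord_inj.
have := Mfirst_prod_ctrl (fun t => phi (ks t)) us.
by rewrite /s !big_map.
Qed.

Lemma Mfirst_U_bwd ks :
  M1 *m U_bwd phi ks *m M1 = P *t adjmx (missT ks).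
Proof.
rewrite -adjmx_U_fwd -{1 2}adjmx_Mfirst -adjmxM -adjmxM mulmxA Mfirst_U_fwd.
by rewrite adjmx_tens adjmx_minusT.
Qed.

Lemma tens_minusT rho :
  P *t rho = M1 *m (1%:M *t rho) *m M1.
Proof. by rewrite !tensmx_mul !mulmx1 minusT_idem mul1mx. Qed.

Lemma mxtrace_tens m p (A : 'M[C]_m) (B : 'M[C]_p) :
  \tr (A *t B) = \tr A * \tr B.
Proof. by rewrite /mxtrace mulr_sum; apply: eq_bigr => i _; rewrite mxE. Qed.

Lemma trace_Mfirst_after rho ks :
  \tr (M1 *m after_i phi rho ks)
  = \tr (missT ks *m rho *m adjmx (missT ks)).
Proof.
rewrite /after_i tens_minusT -{1}Mfirst_idem -mulmxA mxtrace_mulC.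
transitivity (\tr ((P *t missT ks) *m (1%:M *t rho)
    *m adjmx (P *t missT ks))).
  by rewrite -Mfirst_U_fwd !adjmxM !adjmx_Mfirst !mulmxA.
rewrite adjmx_tens adjmx_minusT !tensmx_mul mulmx1 minusT_idem mxtrace_tens.
by rewrite minusT_trace mul1r.
Qed.

Lemma trace_after rho ks : \tr (after_i phi rho ks) = \tr rho.
Proof.
rewrite /after_i mxtrace_mulC mulmxA adjmx_U_fwd U_bwd_fwd mul1mx mxtrace_tens.
by rewrite minusT_trace mul1r.
Qed.

Lemma prob_firstE rho : prob_first T phi rho =
  ((K ^ T)%:R)^-1 * \sum_ks \tr (missT ks *m rho *m adjmx (missT ks)).
Proof. by congr (_ * _); apply: eq_bigr => ks _; apply: trace_Mfirst_after. Qed.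

Lemma prob_secondE rho : (0 < K)%N ->
  prob_second T phi rho = \tr rho - prob_first T phi rho.
Proof.
move=> K0; rewrite /prob_second /prob_first.
under eq_bigr do rewrite mulmxBl mul1mx linearB /= trace_after.
rewrite sumrB mulrBr; congr (_ - _).
rewrite sumr_const card_ffun !card_ord -[X in _ * X]mulr_natl mulKf //.
by rewrite pnatr_eq0 -lt0n expn_gt0 K0.
Qed.

Definition branch_state rho ks : 'M[C]_n :=
  ptrace (U_bwd phi ks *m
    (M1 *m after_i phi rho ks *m M1 + M2 *m after_i phi rho ks *m M2)
    *m adjmx (U_bwd phi ks)).

(** Each outcome contributes a term G (P (x) rho) G* with G = U* M U. For the first outcome G
    compresses to P (x) S' S; since U is unitary, the two G sum to the identity, so the second
    compresses to P (x) (I - S' S). [ptrace_compress] then applies to each term. *)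
Lemma psdmx_branch_state rho ks (A := adjmx (missT ks) *m missT ks) :
  psdmx rho ->
  psdmx (branch_state rho ks
    - (A *m rho *m adjmx A + (1%:M - A) *m rho *m adjmx (1%:M - A))).
Proof.
move=> prho; rewrite /branch_state mulmxDr mulmxDl ptraceD opprD addrACA.
pose G1 := U_bwd phi ks *m M1 *m U_fwd phi ks.
pose G2 := U_bwd phi ks *m M2 *m U_fwd phi ks.
have hM2 : adjmx (M2) = M2.
  by rewrite adjmxB adjmx1 adjmx_Mfirst.
have compG1 : M1 *m G1 *m M1 = P *t A.
  (* Doubling the middle projector separates the backward compression S' from the forward
     compression S. *)
  rewrite /G1 -{2}Mfirst_idem !mulmxA Mfirst_U_bwd -2!mulmxA.
  rewrite (mulmxA (Mfirst _ _ _)).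
  by rewrite Mfirst_U_fwd tensmx_mul minusT_idem.
have compG2 : M1 *m G2 *m M1 = P *t (1%:M - A).
  have -> : G2 = 1%:M - G1.
    by rewrite /G2 mulmxBr mulmxBl mulmx1 U_bwd_fwd.
  by rewrite mulmxBr mulmx1 mulmxBl compG1 Mfirst_idem tensmxBr.
have trM := minusT_trace C T.
have compress := ptrace_compress (adjmx_minusT C T) (minusT_idem C T) trM prho.
apply: psdmxD.
  have := compress _ _ compG1; rewrite /G1 /after_i !adjmxM adjmx_Mfirst.
  by rewrite !mulmxA.
have := compress _ _ compG2; rewrite /G2 /after_i !adjmxM hM2.
by rewrite !mulmxA.
Qed.

End Procedure.

(** * Probabilities and fidelity *)

(** The variance identity: the difference is the mean of (F_i - m) rho (F_i - m)*, a sum of psd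
    terms. *)
Lemma psdmx_variance C n (I : finType) (F : I -> 'M[C]_n) (rho : 'M[C]_n)
    (w := (#|I|%:R)^-1 : C) (m := w *: \sum_i F i) :
  (0 < #|I|)%N -> psdmx rho ->
  psdmx (w *: (\sum_i F i *m rho *m adjmx (F i)) - m *m rho *m adjmx m).
Proof.
move=> I0 prho.
have I0' : (#|I|%:R : C) != 0 by rewrite pnatr_eq0 -lt0n.
have eF : \sum_i F i = #|I|%:R *: m by rewrite scalerA mulfV // scale1r.
clearbody m.
have -> : w *: (\sum_i F i *m rho *m adjmx (F i)) - m *m rho *m adjmx m
    = w *: \sum_i (F i - m) *m rho *m adjmx (F i - m).
  under [in RHS]eq_bigr do rewrite adjmxB mulmxBr !mulmxBl.
  rewrite !sumrB -!mulmx_suml -mulmx_sumr -adjmx_sum eF adjmxZ conjC_nat.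
  rewrite sumr_const -[_ *+ #|_|]scaler_nat -!scalemxAl -scalemxAr subrr subr0.
  by rewrite scalerBr scalerA mulVf // scale1r.
apply: psdmxZ; first by rewrite invr_ge0 ler0n.
by apply: psdmx_sum => i; apply: psdmx_congr.
Qed.

Lemma psdmx_subDl C n (X A B : 'M[C]_n) :
  psdmx (X - (A + B)) -> psdmx B -> psdmx (X - A).
Proof. by move=> pXAB pB; have := psdmxD pXAB pB; rewrite opprD addrA subrK. Qed.

Section Bounds.
Variables (C : numClosedFieldType) (n K : nat) (phi : 'I_K -> 'cV[C]_n).
Hypothesis K_gt0 : (0 < K)%N.
Hypothesis phi_unit : forall k, adjmx (phi k) *m phi k = 1%:M.

(** Apply [fidelity_ge_trace] to the mean m of the B. The gap between the channel output and m rho m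
    is the mean of the gaps assumed psd for each sequence, plus the variance of the B. *)
Lemma fidelity_chanE_ge T (rho : 'M[C]_n) (B : {ffun 'I_T -> 'I_K} -> 'M[C]_n) :
  psdmx rho -> (forall ks, adjmx (B ks) = B ks) ->
  (forall ks, psdmx (branch_state phi rho ks - B ks *m rho *m adjmx (B ks))) ->
  ((K ^ T)%:R)^-1 * \sum_ks \tr (B ks *m rho) <= fidelity (chanE T phi rho) rho.
Proof.
move=> prho hB pB; set w := _^-1; pose m := w *: \sum_ks B ks.
have w0 : 0 <= w by rewrite invr_ge0 ler0n.
have hm : adjmx m = m.
  rewrite adjmxZ adjmx_sum (CrealP _) ?ger0_real //.
  by congr (_ *: _); apply: eq_bigr.
have -> : w * \sum_ks \tr (B ks *m rho) = \tr (m *m rho).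
  by rewrite -scalemxAl mulmx_suml mxtraceZ raddf_sum.
apply: fidelity_ge_trace => //.
have cardks : #|{ffun 'I_T -> 'I_K}| = (K ^ T)%N by rewrite card_ffun !card_ord.
have /= := @psdmx_variance _ _ _ B rho; rewrite cardks expn_gt0 K_gt0 -/w -/m.
move=> /(_ isT prho); set V := \sum_ks _ => pV.
rewrite -(subrK (w *: V) (chanE _ _ _)) -addrA -{2}hm; apply: psdmxD => //.
rewrite -scalerBr; apply: psdmxZ => //; rewrite -sumrB.
exact: psdmx_sum.
Qed.

(** Uses B = S' S, discarding the psd contribution of the second outcome. *)
Lemma fidelity_ge_prob_first T (rho : 'M[C]_n) :
  psdmx rho -> prob_first T phi rho <= fidelity (chanE T phi rho) rho.
Proof.
move=> prho; rewrite prob_firstE.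
under eq_bigr do rewrite mxtrace_mulC mulmxA.
apply: fidelity_chanE_ge => // ks; first by rewrite adjmxM adjmxK.
set A := _ *m missT _ _.
apply: psdmx_subDl (psdmx_congr (1%:M - A) prho).
exact: psdmx_branch_state.
Qed.

(** Uses B = I - S' S, discarding the psd contribution of the first outcome. *)
Lemma fidelity_ge_prob_second T (rho : 'M[C]_n) :
  psdmx rho -> prob_second T phi rho <= fidelity (chanE T phi rho) rho.
Proof.
move=> prho; rewrite prob_secondE // prob_firstE.
have KT0 : (K ^ T)%:R != 0 :> C by rewrite pnatr_eq0 -lt0n expn_gt0 K_gt0.
pose B (ks : {ffun 'I_T -> 'I_K}) := 1%:M - adjmx (missT phi ks) *m missT phi ks.
have trB : \sum_ks \tr (B ks *m rho) = (K ^ T)%:R * \tr rho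
    - \sum_(ks : {ffun 'I_T -> 'I_K})
        \tr (missT phi ks *m rho *m adjmx (missT phi ks)).
  under eq_bigr => ks _ do
    rewrite mulmxBl mul1mx linearB /= -mulmxA (mxtrace_mulC (adjmx _)).
  by rewrite sumrB sumr_const card_ffun !card_ord mulr_natl.
rewrite -[\tr rho](mulKf KT0) -mulrBr -trB.
apply: fidelity_chanE_ge => // ks; first by rewrite adjmxB adjmx1 adjmxM adjmxK.
rewrite /B; set A := adjmx _ *m missT _ _.
apply: psdmx_subDl (psdmx_congr A prho); rewrite [X in _ - X]addrC.
exact: psdmx_branch_state.
Qed.

(** * The spectral bound on the first outcome *)

Lemma sub1_gram_avg : 1%:M - gram_avg phi = K%:R^-1 *: \sum_k miss_proj (phi k).
Proof.
rewrite sumrB scalerBr; congr (_ - _).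
rewrite sumr_const card_ord -scaler_nat scalerA mulVf ?scale1r //.
by rewrite pnatr_eq0 -lt0n.
Qed.

Lemma psdmx_gram_avg : psdmx (gram_avg phi).
Proof.
apply: psdmxZ; first by rewrite invr_ge0 ler0n.
by apply: psdmx_sum => k; apply: psdmx_gram.
Qed.

Lemma psdmx_sub1_gram_avg : psdmx (1%:M - gram_avg phi).
Proof.
rewrite sub1_gram_avg; apply: psdmxZ; first by rewrite invr_ge0 ler0n.
apply: psdmx_sum => k; rewrite -miss_proj_idem // -{2}adjmx_miss_proj.
exact: psdmx_gram.
Qed.

(** The form v* G v is the mean of the |<phi_k|v>|^2, so its vanishing kills every term. *)
Lemma gram_avg_ker (v : 'cV[C]_n) k :
  gram_avg phi *m v = 0 -> adjmx (phi k) *m v = 0.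
Proof.
move=> Gv.
have : \sum_k (adjmx (adjmx (phi k) *m v) *m (adjmx (phi k) *m v)) 0 0 = 0.
  have /(congr1 (fun X => (K%:R *: (adjmx v *m X)) 0 0)) := Gv.
  rewrite mulmx0 scaler0 -scalemxAl -scalemxAr scalerA mulfV ?pnatr_eq0 -?lt0n //.
  rewrite scale1r mulmx_suml mulmx_sumr [RHS]mxE => {2}<-; rewrite summxE.
  by apply: eq_bigr => j _; rewrite adjmxM adjmxK !mulmxA.
move/psumr_eq0P => v0; apply: adjmx_mul_self_eq0; apply: v0 => // l _.
exact: adjmx_mul_self_ge0.
Qed.

Variable lam : C.
Hypothesis lam_eig : eigenvalue (gram_avg phi) lam.
Hypothesis lam_min :
  forall mu, eigenvalue (gram_avg phi) mu -> mu != 0 -> lam <= mu.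

(** Evaluate the psd matrix I - G at an eigenvector for [lam]. *)
Lemma sub1_lam_ge0 : 0 <= 1 - lam.
Proof.
have /eigenvalueP [v vG v0] := lam_eig.
have [_ /(_ (adjmx v))] := psdmx_sub1_gram_avg.
rewrite adjmxK mulmxBr mulmx1 vG -{1}(scale1r v) -scalerBl -scalemxAl mxE.
have vv0 : 0 < (v *m adjmx v) 0 0.
  have := adjmx_mul_self_ge0 (adjmx v); rewrite adjmxK lt_def => ->.
  rewrite andbT; apply: contraNneq v0 => vv.
  rewrite -(adjmxK v) (_ : adjmx v = 0) ?adjmx0 //.
  by apply: adjmx_mul_self_eq0; rewrite adjmxK.
by rewrite pmulr_lge0.
Qed.

(** Compare diagonal entries in an eigenbasis of G. An eigenvector with eigenvalue 0 is orthogonal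
    to all phi_k, hence killed by rho; every other eigenvalue is at least [lam]. *)
Lemma trace_gram_avg_ge (rho : 'M[C]_n) : psdmx rho ->
  (forall v : 'cV[C]_n, (forall k, adjmx (phi k) *m v = 0) -> rho *m v = 0) ->
  lam * \tr rho <= \tr (gram_avg phi *m rho).
Proof.
move=> prho supp.
have [U [d [UU UU' eG d0]]] := psd_spectral psdmx_gram_avg.
have -> : \tr rho = \tr (U *m rho *m adjmx U).
  by rewrite mxtrace_mulC mulmxA UU' mul1mx.
have -> : \tr (gram_avg phi *m rho) = \tr (diag_mx d *m (U *m rho *m adjmx U)).
  by rewrite eG -!mulmxA mxtrace_mulC !mulmxA.
rewrite /mxtrace mulr_sumr; apply: ler_sum => i _.
rewrite mul_diag_mx [in X in _ <= X]mxE.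
have [di0|di0] := eqVneq (d 0 i) 0.
  have Gv : gram_avg phi *m col i (adjmx U) = 0.
    rewrite colE mulmxA eG -(mulmxA _ U) UU mulmx1 -colE.
    by apply/colP => k; rewrite mxE mul_mx_diag !mxE di0 mulr0.
  have := supp _ (fun k => gram_avg_ker k Gv); rewrite colE mulmxA => rv.
  suff -> : (U *m rho *m adjmx U) i i = 0 by rewrite !mulr0.
  have := congr1 (fun X => (U *m X) i 0) rv.
  by rewrite mulmx0 !mulmxA -colE !mxE.
apply: ler_wpM2r; first by apply: psdmx_diag_ge0; apply: psdmx_congr.
apply: lam_min => //; apply/eigenvalueP; exists (row i U).
  rewrite rowE eG !mulmxA -(mulmxA _ U) UU mulmx1 -mulmxA -!rowE.
  by apply/rowP => j; rewrite mxE mul_diag_mx !mxE.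
apply/negP => /eqP Ui; have := congr1 (fun X : 'M_n => X i i) UU.
rewrite !mxE eqxx big1 => [/esym/eqP|j _]; first by rewrite oner_eq0.
by have /rowP/(_ j) := Ui; rewrite !mxE => ->; rewrite mul0r.
Qed.

Lemma sum_ffun_recl (T : nat) (F : {ffun 'I_T.+1 -> 'I_K} -> C) :
  \sum_ks F ks = \sum_k \sum_(ks : {ffun 'I_T -> 'I_K})
    F [ffun t => if unlift ord0 t is Some s then ks s else k].
Proof.
rewrite pair_big /= (reindex (fun p : 'I_K * {ffun 'I_T -> 'I_K} =>
  [ffun t => if unlift ord0 t is Some s then p.2 s else p.1])) //=.
exists (fun ks : {ffun 'I_T.+1 -> 'I_K} =>
  (ks ord0, [ffun t => ks (lift ord0 t)])) => [[k ks]|ks] _.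
  congr (_, _); first by rewrite ffunE unlift_none.
  by apply/ffunP => t; rewrite !ffunE liftK.
by apply/ffunP => t; rewrite ffunE; case: unliftP => [s|] ->; rewrite ?ffunE.
Qed.

Lemma missT_recl T (k : 'I_K) (ks : {ffun 'I_T -> 'I_K}) :
  missT phi [ffun t => if unlift ord0 t is Some s then ks s else k]
  = missT phi ks *m miss_proj (phi k).
Proof.
rewrite /missT big_ord_recr /=; congr (_ *m miss_proj (phi _)).
  apply: eq_bigr => t _; rewrite ffunE; congr (miss_proj (phi _)).
  have -> : rev_ord (widen_ord (leqnSn T) t) = lift ord0 (rev_ord t).
    by apply: val_inj; rewrite /= /bump subSn.
  by rewrite liftK.
have -> : rev_ord (@ord_max T) = ord0 by apply: val_inj; rewrite /= subnn.
by rewrite ffunE unlift_none.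
Qed.

(** Induction on T, peeling off k_1, the reflection applied first. The new state Q_k rho Q_k is not
    normalised, whence the factor [\tr rho]; it still kills every v orthogonal to all phi_k, because
    Q_k fixes such v. Summed over k, the traces give K tr((I - G) rho), at most K (1 - lam) tr
    rho. *)
Lemma sum_missT_le T (rho : 'M[C]_n) : psdmx rho ->
  (forall v : 'cV[C]_n, (forall k, adjmx (phi k) *m v = 0) -> rho *m v = 0) ->
  \sum_(ks : {ffun 'I_T -> 'I_K})
    \tr (missT phi ks *m rho *m adjmx (missT phi ks))
  <= K%:R ^+ T * (1 - lam) ^+ T * \tr rho.
Proof.
elim: T rho => [|T IH] rho prho supp.
  rewrite (eq_bigr (fun=> \tr rho)) => [|ks _].
    by rewrite sumr_const card_ffun !card_ord expn0 !expr0 !mul1r.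
  by rewrite /missT big_ord0 mul1mx [X in _ *m X]adjmx1 mulmx1.
rewrite sum_ffun_recl.
pose step k := miss_proj (phi k) *m rho *m adjmx (miss_proj (phi k)).
apply: (@le_trans _ _ (\sum_k K%:R ^+ T * (1 - lam) ^+ T * \tr (step k))).
  apply: ler_sum => k _.
  under eq_bigr do rewrite missT_recl adjmxM !mulmxA -2!(mulmxA (missT _ _)).
  apply: IH => [|v vphi]; first exact: psdmx_congr.
  have Qv : miss_proj (phi k) *m v = v.
    by rewrite mulmxBl mul1mx -mulmxA vphi mulmx0 subr0.
  by rewrite adjmx_miss_proj -!mulmxA Qv supp ?mulmx0.
have trstep : \sum_k \tr (step k) = K%:R * \tr ((1%:M - gram_avg phi) *m rho).
  rewrite sub1_gram_avg -scalemxAl mxtraceZ mulrA.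
  rewrite mulfV ?pnatr_eq0 -?lt0n // mul1r.
  rewrite mulmx_suml raddf_sum; apply: eq_bigr => k _.
  by rewrite /step mxtrace_mulC adjmx_miss_proj mulmxA miss_proj_idem.
have c0 : 0 <= K%:R ^+ T * (1 - lam) ^+ T :> C.
  by rewrite mulr_ge0 // exprn_ge0 ?ler0n ?sub1_lam_ge0.
have -> : K%:R ^+ T.+1 * (1 - lam) ^+ T.+1 * \tr rho
    = K%:R ^+ T * (1 - lam) ^+ T * (K%:R * ((1 - lam) * \tr rho)).
  by rewrite !exprSr; ring.
rewrite -mulr_sumr trstep !ler_wpM2l ?ler0n //.
by rewrite mulmxBl mul1mx linearB /= mulrBl mul1r lerD2l lerN2 trace_gram_avg_ge.
Qed.

Lemma prob_first_le T (rho : 'M[C]_n) : psdmx rho ->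
  (forall v : 'cV[C]_n, (forall k, adjmx (phi k) *m v = 0) -> rho *m v = 0) ->
  prob_first T phi rho <= (1 - lam) ^+ T * \tr rho.
Proof.
move=> prho supp; rewrite prob_firstE.
have KT : 0 < ((K ^ T)%:R : C) by rewrite ltr0n expn_gt0 K_gt0.
by rewrite ler_pdivrMl // mulrA natrX sum_missT_le.
Qed.

(** Every Q_k fixes rho, hence S rho S' = rho for each sequence. *)
Lemma prob_first_perp T (rho : 'M[C]_n) :
  adjmx rho = rho -> supp_in_perp phi rho -> prob_first T phi rho = \tr rho.
Proof.
move=> hrho perp.
have Srho (ks : {ffun 'I_T -> 'I_K}) : missT phi ks *m rho = rho.
  rewrite /missT; apply: (big_ind (fun X : 'M_n => X *m rho = rho)).
  - exact: mul1mx.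
  - by move=> X Y Xr Yr; rewrite -[X * Y]/(X *m Y) -mulmxA Yr.
  - by move=> t _; rewrite mulmxBl mul1mx -mulmxA perp mulmx0 subr0.
rewrite prob_firstE (eq_bigr (fun=> \tr rho)) => [|ks _].
  rewrite sumr_const card_ffun !card_ord -[X in _ * X]mulr_natl mulKf //.
  by rewrite pnatr_eq0 -lt0n expn_gt0 K_gt0.
by rewrite Srho -{1}hrho -adjmxM Srho hrho.
Qed.

End Bounds.

(** Factor rho through the matrix of the phi_k and take adjoints: rho = rho* then ends in the factor
    whose rows are the <phi_k|, which kills v. *)
Lemma supp_in_span_ker C n K (phi : 'I_K -> 'cV[C]_n) (rho : 'M[C]_n)
    (v : 'cV[C]_n) :
  adjmx rho = rho -> supp_in_span phi rho ->
  (forall k, adjmx (phi k) *m v = 0) -> rho *m v = 0.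
Proof.
move=> hrho /submxP [X eX] vphi.
have -> : rho = adjmx (phimx phi *m X^T).
  by rewrite -[rho]hrho -[X in adjmx X]trmxK eX trmx_mul trmxK.
rewrite adjmxM -mulmxA [X in _ *m X](_ : _ = 0) ?mulmx0 //.
apply/colP => k; rewrite mxE [RHS]mxE.
have /matrixP/(_ 0 0) := vphi k; rewrite mxE [X in _ = X -> _]mxE => vk.
by rewrite -[RHS]vk; apply: eq_bigr => i _; rewrite !mxE.
Qed.

Theorem theorem4 (C : numClosedFieldType) (n K T : nat) (phi : 'I_K -> 'cV[C]_n)
  (lam : C) (rho : 'M[C]_n) :
  (0 < K)%N ->
  (forall k, adjmx (phi k) *m phi k = 1%:M) ->
  (* lam is the minimum nonzero eigenvalue of K^{-1} sum_k |phi_k><phi_k| *)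
  eigenvalue (gram_avg phi) lam -> lam != 0 ->
  (forall mu, eigenvalue (gram_avg phi) mu -> mu != 0 -> lam <= mu) ->
  densitymx rho ->
  (supp_in_span phi rho ->
     prob_first T phi rho <= (1 - lam) ^+ T /\
     1 - (1 - lam) ^+ T <= fidelity (chanE T phi rho) rho) /\
  (supp_in_perp phi rho ->
     prob_second T phi rho <= (1 - lam) ^+ T /\
     1 - (1 - lam) ^+ T <= fidelity (chanE T phi rho) rho).
Proof.
move=> K_gt0 phi_unit lam_eig _ lam_min [prho tr_rho].
have hrho := psdmx_herm prho.
have lamT : 0 <= (1 - lam) ^+ T.
  by rewrite exprn_ge0 // (sub1_lam_ge0 _ _ lam_eig).
split=> [span | perp].
  have p1 : prob_first T phi rho <= (1 - lam) ^+ T.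
    have := prob_first_le K_gt0 phi_unit lam_eig lam_min T prho.
    rewrite tr_rho mulr1; apply=> v; exact: supp_in_span_ker.
  (* Here the second outcome is the correct one, and its probability is one minus the error just
     bounded. *)
  split=> //; apply: le_trans (fidelity_ge_prob_second _ _ _ prho) => //.
  by rewrite prob_secondE // tr_rho lerD2l lerN2.
have p1 := prob_first_perp K_gt0 T hrho perp.
(* On the complement the first outcome is certain, so the error is exactly 0. *)
split; first by rewrite prob_secondE // p1 subrr.
apply: le_trans (fidelity_ge_prob_first _ _ _ prho) => //.
by rewrite p1 tr_rho gerBl.
Qed.
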